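(* Let $X$ be a $[0,1]$-valued random variable distributed uniformly on $[0,1]$, and let $f_4(x) = 4x(1-x)$ for $x \in [0,1]$. Then $f_4\bigl(f_4(X)\bigr)$ is Kumaraswamy-distributed with parameters $\alpha = \beta = \tfrac12$. In terms of the propagation operator $\widetilde f_4$ on cdfs, with $U$ the uniform cdf and $K(\alpha,\beta)$ the Kumaraswamy cdf, $$\widetilde f_4\bigl(\widetilde f_4(U)\bigr) = K\bigl(\tfrac12, \tfrac12\bigr).$$
   Context: A cdf here means a cumulative distribution function with support $[0,1]$: a continuous weakly monotonic function $F:[0,1]\to[0,1]$ with $F(0)=0$ and $F(1)=1$. A random variable $X$ with values in $[0,1]$ is distributed according to $F$, written $X \sim F$, if and only if $P(X\le y) = P(X<y) = F(y)$ for all $y\in[0,1]$. The uniform distribution has cdf $U(y)=y$ for $y \in [0,1]$. The Kumaraswamy distribution with real parameters $\alpha,\beta>0$ has cdf $K(\alpha,\beta)(y) = 1-(1-y^\alpha)^\beta$ for $y\in[0,1]$. For real $r$ with $0<r\le 4$, the logistic map is $f_r:[0,1]\to[0,1]$, $f_r(x)=rx(1-x)$. For a cdf $F$, the propagated cdf $\widetilde f_r(F)$ is defined for $y\in[0,1]$ by $$\widetilde f_r(F)(y) = F\bigl(\tfrac12 - q_r(y)\bigr) + 1 - F\bigl(\tfrac12 + q_r(y)\bigr),$$ where $q_r(y) = \sqrt{\tfrac14 - \tfrac yr}$ if $y\le \tfrac r4$ and $q_r(y)=0$ if $y>\tfrac r4$. *)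

(* Defs.v *)
From HB Require Import structures.
From mathcomp Require Import all_boot all_order all_algebra.
From mathcomp Require Import all_classical all_reals all_analysis.
From mathcomp Require Import measurable_realfun.

Set Implicit Arguments.
Unset Strict Implicit.
Unset Printing Implicit Defensive.

Import Order.TTheory GRing.Theory Num.Theory.
Import numFieldNormedType.Exports.

Local Open Scope classical_set_scope.
Local Open Scope ring_scope.

(* Functions on [0,1] are represented by total functions R -> R; values       *)
(* outside [0,1] are irrelevant, and equality of cdfs is equality on [0,1].   *)

Definition is_cdf01 (R : realType) (F : R -> R) : Prop :=
  [/\ {in `[0, 1], forall y, F y \in `[0, 1]},
      {within [set` `[0, 1]], continuous F},
      {in `[0, 1] &, {homo F : x y / x <= y}},
      F 0 = 0
    & F 1 = 1].

(* X ~ F, for a random variable X with values in [0,1] and a cdf F. *)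
Definition distributed_as (R : realType) (d : measure_display)
    (T : measurableType d) (P : probability T R) (X : {RV P >-> R}) (F : R -> R)
    : Prop :=
  [/\ forall t, X t \in `[0, 1],
      is_cdf01 F
    & {in `[0, 1], forall y,
        P [set t | X t <= y] = (F y)%:E /\ P [set t | X t < y] = (F y)%:E}].

Arguments distributed_as {R d T} P X F.

Definition uniform_cdf (R : realType) (y : R) : R := y.

Definition kumaraswamy_cdf (R : realType) (alpha beta y : R) : R :=
  1 - (1 - y `^ alpha) `^ beta.

Definition logistic (R : realType) (r x : R) : R := r * x * (1 - x).

Lemma measurable_logistic (R : realType) (r : R) :
  measurable_fun setT (logistic r).
Proof.
apply: measurable_funM; first exact: measurable_funM.
exact: measurable_funB.
Qed.

HB.instance Definition _ (R : realType) (r : R) :=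
  isMeasurableFun.Build _ _ R R (logistic r) (measurable_logistic r).

Definition logistic_q (R : realType) (r y : R) : R :=
  if y <= r / 4 then Num.sqrt (1 / 4 - y / r) else 0.

Definition propagate (R : realType) (r : R) (F : R -> R) (y : R) : R :=
  F (1 / 2 - logistic_q r y) + 1 - F (1 / 2 + logistic_q r y).

(* Main.v *)
(* Since f_r(x) <= y iff |x - 1/2| >= q_r(y), the law of f_r(X) has the
   propagated cdf.  Propagating U once gives 1 - sqrt(1 - y); propagating twice
   gives 1 - (sqrt(1/2 + q) - sqrt(1/2 - q)) with q = sqrt(1 - y) / 2, and the
   square of the bracket is 1 - 2 sqrt(1/4 - q^2) = 1 - sqrt(y). *)

Require Import Defs.
From HB Require Import structures.
From mathcomp Require Import all_boot all_order all_algebra.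
From mathcomp Require Import all_classical all_reals all_analysis.
From mathcomp Require Import ring lra.

Set Implicit Arguments.
Unset Strict Implicit.
Unset Printing Implicit Defensive.

Import Order.TTheory GRing.Theory Num.Theory.
Import numFieldNormedType.Exports.

Local Open Scope classical_set_scope.
Local Open Scope ring_scope.

(** A cdf is continuous only relative to [0,1], so composing it with [1/2 - q] or [1/2 + q] calls
    for relative continuity of the outer map too. *)
Lemma within_continuous_comp_within (T U V : topologicalType) (A : set T)
    (B : set U) (f : T -> U) (g : U -> V) :
  {homo f : x / A x >-> B x} -> {within A, continuous f} ->
  {within B, continuous g} -> {within A, continuous (g \o f)}.
Proof.
move=> fAB /subspace_continuousP cf /subspace_continuousP cg.
apply/subspace_continuousP => x Ax W /(cg _ (fAB _ Ax)).
move=> /(cf _ Ax); rewrite /= /nbhs /= /within /=.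
by apply: filterS => t /[swap] At /(_ At); apply; exact: fAB.
Qed.

Lemma sqrt_le_norm (R : rcfType) (c t : R) :
  (Num.sqrt c <= `|t|) = (c <= t ^+ 2).
Proof. by rewrite -sqrtr_sqr ler_sqrt// sqr_ge0. Qed.

(** For c < 0 the root defaults to 0, so the strict comparison would fail at t = 0; in the
    non-strict one both sides are then true. *)
Lemma sqrt_lt_norm (R : rcfType) (c t : R) :
  0 <= c -> (Num.sqrt c < `|t|) = (c < t ^+ 2).
Proof. by move=> c0; rewrite !ltNge -sqrtr_sqr ler_sqrt. Qed.

(** * Sublevel sets of the logistic map and the law of its image *)

Section LogisticPropagation.
Variables (R : realType) (r : R).
Hypothesis r_gt0 : 0 < r.

(** The root of a negative number is 0 by convention, which absorbs the case y > r/4. *)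
Lemma logistic_qE y : logistic_q r y = Num.sqrt (1 / 4 - y / r).
Proof.
rewrite /logistic_q; case: leP => // ry; rewrite ler0_sqrtr//.
rewrite subr_le0 ler_pdivlMr//; lra.
Qed.

Lemma logistic_q_ge0 y : 0 <= logistic_q r y.
Proof. by rewrite logistic_qE sqrtr_ge0. Qed.

Lemma logistic_q_homo y z : y <= z -> logistic_q r z <= logistic_q r y.
Proof.
move=> yz; rewrite !logistic_qE ler_wsqrtr// lerD2l lerN2 ler_pM2r ?invr_gt0//.
Qed.

Lemma logistic_q0 : logistic_q r 0 = 1 / 2.
Proof.
rewrite logistic_qE (_ : 1 / 4 - 0 / r = (1 / 2) ^+ 2); last first.
  by field; rewrite gt_eqF.
by rewrite sqrtr_sqr ger0_norm//; lra.
Qed.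

Lemma logistic_q_le y : 0 <= y -> logistic_q r y <= 1 / 2.
Proof. by move=> y0; rewrite -logistic_q0 logistic_q_homo. Qed.

Lemma logistic_q_continuous : continuous (logistic_q r).
Proof.
rewrite (_ : logistic_q r = fun y => Num.sqrt (1 / 4 - y / r)); last first.
  by apply/funext => y; exact: logistic_qE.
move=> y; apply: continuous_comp; last exact: sqrt_continuous.
by apply: cvgB; [exact: cvg_cst|apply: cvgM; [exact: cvg_id|exact: cvg_cst]].
Qed.

(** Completing the square turns comparisons of f_r(x) with y into comparisons of |x - 1/2| with
    q. *)
Lemma logisticE x y :
  y - logistic r x = r * ((x - 1 / 2) ^+ 2 - (1 / 4 - y / r)).
Proof. by rewrite /logistic; field; rewrite gt_eqF. Qed.

Lemma logistic_le x y : (logistic r x <= y) =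
  (x <= 1 / 2 - logistic_q r y) || (1 / 2 + logistic_q r y <= x).
Proof.
rewrite -subr_ge0 logisticE pmulr_rge0// subr_ge0 logistic_qE.
rewrite -sqrt_le_norm ler_normr orbC; congr orb; apply/idP/idP; lra.
Qed.

(** Above the maximum r/4 one has q = 0, and x = 1/2 would satisfy the left side but neither
    disjunct. *)
Lemma logistic_lt x y : y <= r / 4 -> (logistic r x < y) =
  (x < 1 / 2 - logistic_q r y) || (1 / 2 + logistic_q r y < x).
Proof.
move=> yr; rewrite -subr_gt0 logisticE pmulr_rgt0// subr_gt0 logistic_qE.
have c0 : 0 <= 1 / 4 - y / r by rewrite subr_ge0 ler_pdivrMr//; lra.
rewrite -sqrt_lt_norm// ltr_normr orbC; congr orb; apply/idP/idP; lra.
Qed.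

Lemma is_cdf01_propagate F : is_cdf01 F -> r <= 4 -> is_cdf01 (propagate r F).
Proof.
move=> [F01 Fc Fle F0 F1] r4.
have qm y : y \in `[0, 1] -> 1 / 2 - logistic_q r y \in `[0, 1].
  rewrite !in_itv/= => /andP[y0 _].
  have := logistic_q_ge0 y; have := logistic_q_le y0; lra.
have qp y : y \in `[0, 1] -> 1 / 2 + logistic_q r y \in `[0, 1].
  rewrite !in_itv/= => /andP[y0 _].
  have := logistic_q_ge0 y; have := logistic_q_le y0; lra.
split.
- move=> y y01; have : F (1 / 2 - logistic_q r y) <= F (1 / 2 + logistic_q r y).
    by apply: Fle; [exact: qm|exact: qp|have := logistic_q_ge0 y; lra].
  move: (F01 _ (qm _ y01)) (F01 _ (qp _ y01)).
  rewrite !in_itv/= /propagate; lra.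
- have cm : {within `[0, 1], continuous (fun y => F (1 / 2 - logistic_q r y))}.
    apply: (within_continuous_comp_within _ _ Fc); first exact: qm.
    apply: continuous_subspaceT => y.
    by apply: cvgB; [exact: cvg_cst|exact: logistic_q_continuous].
  have cp : {within `[0, 1], continuous (fun y => F (1 / 2 + logistic_q r y))}.
    apply: (within_continuous_comp_within _ _ Fc); first exact: qp.
    apply: continuous_subspaceT => y.
    by apply: cvgD; [exact: cvg_cst|exact: logistic_q_continuous].
  have c1 : {within `[0, 1], continuous (cst 1 : R -> R)}.
    by apply: continuous_subspaceT => y; exact: cvg_cst.
  exact: within_continuousB (within_continuousD cm c1) cp.
- move=> y z y01 z01 yz; rewrite /propagate; have := logistic_q_homo yz => qzy.
  have := Fle _ _ (qm _ y01) (qm _ z01); have := Fle _ _ (qp _ z01) (qp _ y01).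
  by move=> /(_ ltac:(lra)) + /(_ ltac:(lra)); lra.
- rewrite /propagate logistic_q0 (_ : 1 / 2 - 1 / 2 = 0); last by lra.
  by rewrite (_ : 1 / 2 + 1 / 2 = 1); [rewrite F0 F1; lra|lra].
(* Since r <= 4, the radicand 1/4 - 1/r is nonpositive, so q = 0 and the two values F(1/2)
   cancel. *)
- rewrite /propagate logistic_qE ler0_sqrtr ?addr0 ?subr0; first by lra.
  by rewrite subr_le0 ler_pdivlMr//; lra.
Qed.

Lemma distributed_as_logistic (d : measure_display) (T : measurableType d)
    (P : probability T R) (X : {RV P >-> R}) (F : R -> R) :
  r <= 4 -> distributed_as P X F ->
  distributed_as P (logistic r \o X) (propagate r F).
Proof.
move=> r4 [X01 cdfF PX].
have mle a : measurable [set t | X t <= a].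
  by rewrite -preimage_itvNyc; exact: measurable_funPTI.
have mlt a : measurable [set t | X t < a].
  by rewrite -preimage_itvNyo; exact: measurable_funPTI.
(* The event for f_r(X) splits into a lower tail A and the complement of B, where B lies below the
   upper tail; its probability has the shape of [propagate]. *)
have PU (A B : set T) (a b : R) : measurable A -> measurable B -> A `<=` B ->
    P A = a%:E -> P B = b%:E -> P (A `|` ~` B) = (a + 1 - b)%:E.
  move=> mA mB AB PA PB; have -> : P (A `|` ~` B) = (P A + P (~` B))%E.
    apply: measureU => //; first exact: measurableC.
    by apply/disjoints_subset; rewrite setCK.
  by rewrite probability_setC// PA PB -EFinB -EFinD addrA.
have PT a : P [set: T] = (a + 1 - a)%:E.
  by rewrite probability_setT addrAC subrr add0r.
have half y : r / 4 <= y -> logistic_q r y = 0.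
  by move=> ry; rewrite logistic_qE ler0_sqrtr// subr_le0 ler_pdivlMr//; lra.
split; [|exact: is_cdf01_propagate|].
- move=> t; have := X01 t; rewrite !in_itv/= /logistic => /andP[X0 X1].
  apply/andP; split; first by rewrite !mulr_ge0 ?(ltW r_gt0)//; lra.
  (* The upper bound comes from 1 - r x (1 - x) = (4 - r) x (1 - x) + 4 (x - 1/2)^2. *)
  have : 0 <= (4 - r) * (X t * (1 - X t)) by rewrite !mulr_ge0//; lra.
  have := sqr_ge0 (X t - 1 / 2); rewrite expr2; lra.
move=> y y01; have /andP[y0 y1] : 0 <= y <= 1 by move: y01; rewrite in_itv.
have q0 := logistic_q_ge0 y; have q12 := logistic_q_le y0.
have [Pmle Pmlt] : P [set t | X t <= 1 / 2 - logistic_q r y] =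
    (F (1 / 2 - logistic_q r y))%:E /\
    P [set t | X t < 1 / 2 - logistic_q r y] =
    (F (1 / 2 - logistic_q r y))%:E by apply: PX; rewrite in_itv/=; lra.
have [Pple Pplt] : P [set t | X t <= 1 / 2 + logistic_q r y] =
    (F (1 / 2 + logistic_q r y))%:E /\
    P [set t | X t < 1 / 2 + logistic_q r y] =
    (F (1 / 2 + logistic_q r y))%:E by apply: PX; rewrite in_itv/=; lra.
split.
  (* For q = 0 the two halves overlap and cover the whole space. *)
- have [qpos|] := ltP 0 (logistic_q r y).
    rewrite -(PU _ _ _ _ _ _ _ Pmle Pplt) //; last by move=> t /=; lra.
    congr (P _); apply/seteqP; split => t /=;
      rewrite logistic_le (leNgt (1 / 2 + _)).
      by move=> /orP[|/negP]; [left|right].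
    by move=> [->//|/negP ->]; rewrite orbT.
  move=> qle0; rewrite /propagate (_ : logistic_q r y = 0); last by lra.
  rewrite addr0 subr0 -PT; congr (P _); apply/seteqP; split => // t _ /=.
  rewrite logistic_le (_ : logistic_q r y = 0) ?addr0 ?subr0 ?le_total//; lra.
(* With strict lower and non-strict upper bound, A is contained in B even for q = 0. For y > r/4 the
   event is the whole space. *)
- have [yr|ry] := leP y (r / 4).
    rewrite -(PU _ _ _ _ _ _ _ Pmlt Pple) //; last by move=> t /=; lra.
    congr (P _); apply/seteqP; split => t /=;
      rewrite logistic_lt// (ltNge (1 / 2 + _)).
      by move=> /orP[|/negP]; [left|right].
    by move=> [->//|/negP ->]; rewrite orbT.
  rewrite /propagate half ?ltW// addr0 subr0 -PT.
  congr (P _); apply/seteqP; split => // t _ /=.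
  rewrite -subr_gt0 logisticE mulr_gt0// ltr_wpDl ?sqr_ge0//.
  by rewrite opprB subr_gt0 ltr_pdivlMr//; lra.
Qed.

End LogisticPropagation.

(** * Cdfs up to equality on [0,1], and the case r = 4 started from U *)

Lemma is_cdf01_eq (R : realType) (F G : R -> R) :
  {in `[0, 1], F =1 G} -> is_cdf01 F -> is_cdf01 G.
Proof.
move=> FG [F01 Fc Fle F0 F1].
have i0 : (0 : R) \in `[0, 1] by rewrite in_itv/= lexx ler01.
have i1 : (1 : R) \in `[0, 1] by rewrite in_itv/= lexx ler01.
split; rewrite -?FG//.
- by move=> y y01; rewrite -FG// F01.
- by apply: subspace_eq_continuous Fc => x; rewrite inE => /FG.
- by move=> x y x01 y01 xy; rewrite -!FG// Fle.
Qed.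

Lemma distributed_as_eq (R : realType) (d : measure_display)
    (T : measurableType d) (P : probability T R) (X : {RV P >-> R})
    (F G : R -> R) :
  {in `[0, 1], F =1 G} -> distributed_as P X F -> distributed_as P X G.
Proof.
move=> FG [X01 cF PX]; split => //; first exact: is_cdf01_eq cF.
by move=> y y01; rewrite -FG//; exact: PX.
Qed.

(** The left side is 1 - 2q, and 2q = sqrt(1 - y). With y unrestricted, it rewrites inside the outer
    [propagate] without side conditions. *)
Lemma propagate_uniform (R : realType) (y : R) :
  propagate 4 (@uniform_cdf R) y = 1 - Num.sqrt (1 - y).
Proof.
rewrite /propagate /uniform_cdf logistic_qE//.
rewrite (_ : 1 / 4 - y / 4 = (1 / 2) ^+ 2 * (1 - y)); last by field.
by rewrite sqrtrM ?sqr_ge0// sqrtr_sqr ger0_norm; lra.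
Qed.

Lemma propagate_propagate_uniform (R : realType) :
  {in `[0, 1], propagate 4 (propagate 4 (@uniform_cdf R))
               =1 kumaraswamy_cdf (1 / 2) (1 / 2)}.
Proof.
move=> y; rewrite in_itv/= => /andP[y0 y1].
rewrite /kumaraswamy_cdf div1r {1}/propagate !propagate_uniform.
have sy1 : Num.sqrt y <= 1 by rewrite -sqrtr1 ler_wsqrtr.
rewrite powR12_sqrt// powR12_sqrt ?subr_ge0//.
set q := logistic_q 4 y.
have q0 : 0 <= q by exact: logistic_q_ge0.
have q12 : q <= 1 / 2 by apply: logistic_q_le.
have qE : q ^+ 2 = (1 - y) / 4.
  by rewrite /q logistic_qE// sqr_sqrtr; lra.
(* Here a^2 = 1/2 + q and b^2 = 1/2 - q, and the left side of the goal is (1 - a) + 1 - (1 - b). *)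
set a := Num.sqrt (1 - (1 / 2 - q)); set b := Num.sqrt (1 - (1 / 2 + q)).
suff -> : Num.sqrt (1 - Num.sqrt y) = a - b by lra.
have ba : b <= a by apply: ler_wsqrtr; lra.
have ab : a * b = Num.sqrt y / 2.
  rewrite -sqrtrM; last by lra.
  rewrite (_ : _ * _ = (1 / 2) ^+ 2 * y); last first.
    by transitivity (1 / 4 - q ^+ 2); [field|rewrite qE; field].
  by rewrite sqrtrM ?sqr_ge0// sqrtr_sqr ger0_norm; lra.
(* Uses a^2 + b^2 = 1 and 2ab = sqrt(y); then b <= a fixes the sign of the root. *)
have -> : 1 - Num.sqrt y = (a - b) ^+ 2.
  by rewrite sqrrB ab !sqr_sqrtr; lra.
by rewrite sqrtr_sqr ger0_norm// subr_ge0.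
Qed.

Theorem theorem3 (R : realType) :
  (forall (d : measure_display) (T : measurableType d) (P : probability T R)
      (X : {RV P >-> R}),
     distributed_as P X (@uniform_cdf R) ->
     distributed_as P (logistic (4 : R) \o (logistic (4 : R) \o X))
       (kumaraswamy_cdf (1 / 2) (1 / 2)))
  /\ {in `[0, 1], propagate 4 (propagate 4 (@uniform_cdf R))
                  =1 kumaraswamy_cdf (1 / 2) (1 / 2)}.
Proof.
split; last exact: propagate_propagate_uniform.
move=> d T P X XU; apply: distributed_as_eq (@propagate_propagate_uniform R) _.
by do 2![apply: distributed_as_logistic => //].
Qed.
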